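(* Let $H$ be a complex Hilbert space and let $M_0,M_1\in L(H)$ be such that $R(M_0)$ is closed and the linear operator pencil $\mathcal{M}$ associated with $(M_0,M_1)$ is regular. Let $u_0\in\mathrm{IV}:=\{x\in H:M_1x\in R(M_0)\}$. Then there exists a unique solution $u:\mathbb{R}_{\ge0}\to H$ of $$M_0u'(t)+M_1u(t)=0\quad(t>0),\qquad u(0)=u_0,$$ which is given by $$u(t)=\exp\left(-t\left(\iota_{R(M_0)}^{*}M_0\iota_{\mathrm{IV}}\right)^{-1}\left(\iota_{R(M_0)}^{*}M_1\iota_{\mathrm{IV}}\right)\right)u_0\quad(t\ge0).$$
   Context: $L(H)$ is the space of bounded linear operators on $H$; $R(M_0)$ denotes the range. For a closed subspace $S\subseteq H$, $\iota_S:S\hookrightarrow H$ is the canonical embedding and $\iota_S^{*}:H\to S$ its adjoint (the orthogonal projection onto $S$). The set $\mathrm{IV}$ is a closed subspace of $H$, and the operator $\iota_{R(M_0)}^{*}M_0\iota_{\mathrm{IV}}:\mathrm{IV}\to R(M_0)$ is continuously invertible, so the exponent is a bounded operator on $\mathrm{IV}$. The linear operator pencil associated with $(M_0,M_1)$ is $\mathcal{M}(z)=zM_0+M_1$, $z\in\mathbb{C}$. It is called regular (of index $0$) if there is $\nu\in\mathbb{R}$ such that $zM_0+M_1$ is boundedly invertible for all $z$ with $\operatorname{Re}z>\nu$ and $z\mapsto(zM_0+M_1)^{-1}\in L(H)$ is bounded on $\{z:\operatorname{Re}z>\nu\}$. A solution of the initial value problem is a continuous function $u:\mathbb{R}_{\ge0}\to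 H$ which is continuously differentiable on $\mathbb{R}_{>0}$ and satisfies the two equations. *)

(* Defs.v *)
From HB Require Import structures.
From mathcomp Require Import all_boot all_order all_algebra.
From mathcomp Require Import all_classical all_reals all_analysis.
From mathcomp Require Import complex.

Set Implicit Arguments.
Unset Strict Implicit.
Unset Printing Implicit Defensive.

Import Order.TTheory GRing.Theory Num.Theory.
Import numFieldNormedType.Exports.

Local Open Scope classical_set_scope.
Local Open Scope ring_scope.
Local Open Scope complex_scope.

(* The inner product is linear in its first argument and conjugate-linear in
   the second one. *)
HB.mixin Record CompleteNormedModule_isHilbert (R : realType) (H : Type)
    & CompleteNormedModule R[i] H := {
  inner : {dot H for @Num.conj R[i]} ;
  inner_norm : forall x : H, inner x x = `|x| ^+ 2
}.

#[short(type="hilbertType")]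
HB.structure Definition Hilbert (R : realType) :=
  {H of CompleteNormedModule R[i] H & CompleteNormedModule_isHilbert R H}.

Section BoundedOperators.
Variables (R : realType) (E F : normedModType R[i]).

Definition bounded_operator (f : E -> F) :=
  linear f /\ exists C : R[i], forall x, `|f x| <= C * `|x|.

Definition bop_pred : {pred (E -> F)} := fun f => `[< bounded_operator f >].

Record bop := Bop { bop_fun :> E -> F ; bop_funP : bop_fun \in bop_pred }.

HB.instance Definition _ := [isSub of bop for bop_fun].
HB.instance Definition _ := [Choice of bop by <:].

Lemma bop_submod_closed : subsemimod_closed bop_pred.
Proof.
split; first split.
- apply/asboolP; split; first by move=> a x y; rewrite [LHS]/= scaler0 addr0.
  by exists 0 => x; rewrite mul0r normr0.
- move=> f g /asboolP[lf [C hC]] /asboolP[lg [D hD]]; apply/asboolP; split.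
    move=> a x y; rewrite -[LHS]/(f _ + g _) lf lg addrACA -scalerDr.
    by [].
  exists (C + D) => x; rewrite mulrDl -[(f + g) x]/(f x + g x).
  exact: le_trans (ler_normD _ _) (lerD _ _).
- move=> c f /asboolP[lf [C hC]]; apply/asboolP; split.
    move=> a x y; rewrite -[LHS]/(c *: f _) lf scalerDr !scalerA mulrC.
    by rewrite -scalerA.
  exists (`|c| * C) => x; rewrite -[(c *: f) x]/(c *: f x) normrZ -mulrA.
  exact: ler_wpM2l.
Qed.

HB.instance Definition _ :=
  GRing.SubChoice_isSubLmodule.Build R[i] (E -> F) bop_pred bop bop_submod_closed.

Lemma bop_linear (T : bop) : linear T.
Proof. by case/asboolP: (bop_funP T). Qed.

HB.instance Definition _ (T : bop) :=
  GRing.isLinear.Build R[i] E F _ T (@bop_linear T).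

Lemma bop_bounded (T : bop) : exists C : R[i], forall x, `|T x| <= C * `|x|.
Proof. by case/asboolP: (bop_funP T). Qed.

Lemma bop_ext (S T : bop) : S =1 T -> S = T.
Proof. by move=> h; apply/val_inj/funext. Qed.

(* Norms take values in R[i], hence the conversions to and from R. *)
Definition opnorm (T : bop) : R[i] :=
  (sup [set complex.Re `|T x| | x in [set x : E | `|x| <= 1]])%:C.

Lemma bop_bounded_ge0 (T : bop) :
  exists2 C : R, 0 <= C & forall x, `|T x| <= C%:C * `|x|.
Proof.
have [C hC] := bop_bounded T; exists (complex.Re `|C|).
  by rewrite -ler0c RRe_real ?normr_real.
move=> x; rewrite RRe_real ?normr_real// -[X in _ * X]normr_id -normrM.
by rewrite ger0_norm ?hC// (le_trans _ (hC x)).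
Qed.

Lemma opnorm_ub (T : bop) (x : E) : `|x| <= 1 -> `|T x| <= opnorm T.
Proof.
move=> x1; have [C C0 hC] := bop_bounded_ge0 T.
rewrite -[leLHS]RRe_real ?normr_real// lecR.
apply: sup_upper_bound; last by exists x.
split; first by exists (complex.Re `|T 0|), 0 => //=; rewrite normr0.
exists C => _ [y /= y1 <-]; rewrite -lecR RRe_real ?normr_real//.
by rewrite (le_trans (hC y))// ler_piMr// ler0c.
Qed.

Lemma opnorm_ge0 (T : bop) : 0 <= opnorm T.
Proof. by apply: le_trans (opnorm_ub T (x := 0) _); rewrite ?normr0. Qed.

Lemma opnorm_bound (T : bop) (x : E) : `|T x| <= opnorm T * `|x|.
Proof.
have [->|x0] := eqVneq x 0; first by rewrite linear0 !normr0 mulr0.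
have nx : 0 < `|x| by rewrite normr_gt0.
rewrite -ler_pdivrMr// mulrC -[in X in X * _](ger0_norm (ltW nx)) -normfV.
rewrite -normrZ -linearZ; apply: opnorm_ub.
by rewrite normrZ normfV normr_id mulVf// gt_eqF.
Qed.

Lemma opnorm_le (T : bop) (c : R[i]) :
  0 <= c -> (forall x, `|T x| <= c * `|x|) -> opnorm T <= c.
Proof.
move=> c0 hc; rewrite -[leRHS]RRe_real ?ger0_real// lecR.
apply: ge_sup; first by exists (complex.Re `|T 0|), 0 => //=; rewrite normr0.
move=> _ [y /= y1 <-]; rewrite -lecR !RRe_real ?normr_real ?ger0_real//.
by rewrite (le_trans (hc y))// ler_piMr.
Qed.

Lemma opnormD (S T : bop) : opnorm (S + T) <= opnorm S + opnorm T.
Proof.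
apply: opnorm_le => [|x]; first by rewrite addr_ge0 ?opnorm_ge0.
rewrite mulrDl -[(S + T) x]/(S x + T x).
by rewrite (le_trans (ler_normD _ _))// lerD ?opnorm_bound.
Qed.

Lemma opnormZ_le (l : R[i]) (T : bop) : opnorm (l *: T) <= `|l| * opnorm T.
Proof.
apply: opnorm_le => [|x]; first by rewrite mulr_ge0 ?opnorm_ge0.
by rewrite -[(l *: T) x]/(l *: T x) normrZ -mulrA ler_wpM2l ?opnorm_bound.
Qed.

Lemma opnormZ (l : R[i]) (T : bop) : opnorm (l *: T) = `|l| * opnorm T.
Proof.
apply/eqP; rewrite eq_le opnormZ_le /=.
have [->|l0] := eqVneq l 0; first by rewrite normr0 mul0r opnorm_ge0.
rewrite mulrC -ler_pdivlMr ?normr_gt0// mulrC -normfV.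
by rewrite -[in leLHS](scale1r T) -(mulVf l0) -scalerA opnormZ_le.
Qed.

Lemma opnorm0_eq0 (T : bop) : opnorm T = 0 -> T = 0.
Proof.
move=> T0; apply: bop_ext => x; apply/eqP.
by rewrite -normr_le0 (le_trans (opnorm_bound T x))// T0 mul0r.
Qed.

HB.instance Definition _ :=
  Lmodule_isNormed.Build R[i] bop opnormD opnormZ opnorm0_eq0.

End BoundedOperators.

Arguments bop {R} E F.
Notation "''L' ( E , F )" := (bop E F) : type_scope.

Section OperatorAlgebra.
Variables (R : realType).
Implicit Types E F G : normedModType R[i].

Lemma bid_subproof E : (idfun : E -> E) \in @bop_pred R E E.
Proof. by apply/asboolP; split=> //; exists 1 => x; rewrite mul1r. Qed.

Definition bid E : 'L(E, E) := Bop (bid_subproof E).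

Lemma bcomp_subproof E F G (S : 'L(F, G)) (T : 'L(E, F)) :
  (S \o T) \in @bop_pred R E G.
Proof.
apply/asboolP; split=> [a x y|]; first by rewrite /= !linearP.
have [C C0 hC] := bop_bounded_ge0 S; have [D D0 hD] := bop_bounded_ge0 T.
exists (C%:C * D%:C) => x; rewrite -mulrA (le_trans (hC _))//.
by rewrite ler_wpM2l ?ler0c.
Qed.

Definition bcomp E F G (S : 'L(F, G)) (T : 'L(E, F)) : 'L(E, G) :=
  Bop (bcomp_subproof S T).

Definition is_binverse E F (T : 'L(E, F)) (S : 'L(F, E)) :=
  bcomp S T = bid E /\ bcomp T S = bid F.

Definition boundedly_invertible E F (T : 'L(E, F)) := exists S, is_binverse T S.

(* The inverse is 0 when T is not boundedly invertible. *)
Definition binv E F (T : 'L(E, F)) : 'L(F, E) := xget 0 (is_binverse T).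

Definition bpow E (T : 'L(E, E)) (n : nat) : 'L(E, E) := iter n (bcomp T) (bid E).

(* The limit is taken in the operator norm. *)
Definition bexp E (T : 'L(E, E)) : 'L(E, E) :=
  limn (series (fun n => (n`!%:R : R[i])^-1 *: bpow T n)).

End OperatorAlgebra.

(* By the Riesz representation theorem the set below is a singleton. *)
Definition adjoint (R : realType) (H K : hilbertType R) (T : 'L(H, K)) :
    'L(K, H) :=
  xget 0 [set S : 'L(K, H) |
    forall (x : H) (y : K), inner (T x) y = inner x (S y)].

Record closedSubspace (R : realType) (H : hilbertType R) := ClosedSubspace {
  csub_set :> set H ;
  csub_submod : subsemimod_closed [pred x | x \in csub_set] ;
  csub_closed : closed csub_set
}.

Section Subspace.
Variables (R : realType) (H : hilbertType R) (S : closedSubspace H).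

Definition csub_pred : {pred H} := [pred x | x \in (S : set H)].

Record subspace_of := SubspaceOf {
  subspace_val : H ; subspace_valP : subspace_val \in csub_pred }.

HB.instance Definition _ := [isSub of subspace_of for subspace_val].
HB.instance Definition _ := [Choice of subspace_of by <:].
HB.instance Definition _ :=
  GRing.SubChoice_isSubLmodule.Build R[i] H csub_pred subspace_of
    (csub_submod S).

Local Notation val := subspace_val.

Lemma subspace_val_linear : linear val.
Proof. by []. Qed.

HB.instance Definition _ :=
  GRing.isLinear.Build R[i] subspace_of H _ val subspace_val_linear.

Definition subspace_norm (x : subspace_of) : R[i] := `|val x|.

Lemma subspace_normD x y :
  subspace_norm (x + y) <= subspace_norm x + subspace_norm y.
Proof. exact: ler_normD. Qed.

Lemma subspace_normZ l x : subspace_norm (l *: x) = `|l| * subspace_norm x.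
Proof. exact: normrZ. Qed.

Lemma subspace_norm0_eq0 x : subspace_norm x = 0 -> x = 0.
Proof. by move=> /normr0_eq0 ?; apply/val_inj. Qed.

HB.instance Definition _ := Lmodule_isNormed.Build R[i] subspace_of
  subspace_normD subspace_normZ subspace_norm0_eq0.

Lemma subspace_normE (x : subspace_of) : `|x| = `|val x|.
Proof. by []. Qed.

Lemma subspace_complete (F : set_system subspace_of) :
  ProperFilter F -> cauchy F -> cvg F.
Proof.
move=> FF /cauchy_ballP F_cauchy.
have cF : cauchy (val @ F).
  apply/cauchy_ballP => e e0; have [[A B] /= [FA FB] AB] := F_cauchy e e0.
  exists (val @` A, val @` B); first by split; [move: FA|move: FB];
    apply: filterS => x ?; exists x.
  move=> [_ _] /= [[x Ax <-] [y By <-]]; have := AB (x, y) (conj Ax By).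
  by rewrite /= -!ball_normE.
have /cauchy_cvg /cvg_ex[l Fl] := cF.
have Sl : (S : set H) l.
  apply: (@closed_cvg _ _ F _ val (S : set H) (@csub_closed _ _ S) _ l) => //.
  by apply: nearW => x; apply/set_mem/subspace_valP.
apply/cvg_ex; exists (SubspaceOf (mem_set Sl)).
apply/cvgrPdist_lt => e e0; move/cvgrPdist_lt : Fl => /(_ e e0).
by apply: filterS => x.
Qed.

HB.instance Definition _ :=
  Uniform_isComplete.Build subspace_of subspace_complete.

Definition subspace_inner (x y : subspace_of) : R[i] :=
  @inner R H (val x) (val y).

Lemma subspace_inner_zmodl y : zmod_morphism (subspace_inner ^~ y).
Proof. by move=> x z; exact: linearBl. Qed.

Lemma subspace_inner_zmodr x : zmod_morphism (subspace_inner x).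
Proof. by move=> y z; exact: linearBr. Qed.

Lemma subspace_inner_scalel y : scalable_for *%R (subspace_inner ^~ y).
Proof. by move=> a x; exact: linearZl_LR. Qed.

Lemma subspace_inner_scaler x :
  scalable_for (@Num.conj R[i] \; *%R) (subspace_inner x).
Proof. by move=> a y; exact: linearZr_LR. Qed.

HB.instance Definition _ := isBilinear.Build R[i] subspace_of subspace_of R[i]
  *%R (@Num.conj R[i] \; *%R) subspace_inner
  subspace_inner_zmodl subspace_inner_zmodr
  subspace_inner_scalel subspace_inner_scaler.

Lemma subspace_inner_hermitian x y :
  subspace_inner x y = (-1) ^+ false * Num.conj (subspace_inner y x).
Proof. exact: hermC. Qed.

HB.instance Definition _ := isHermitianSesquilinear.Build R[i] subspace_of
  false (@Num.conj R[i]) subspace_inner subspace_inner_hermitian.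

Lemma subspace_inner_gt0 x : x != 0 -> 0 < subspace_inner x x.
Proof. by move=> x0; apply: neq0_dnorm_gt0. Qed.

HB.instance Definition _ := isDotProduct.Build R[i] subspace_of
  subspace_inner subspace_inner_gt0.

Lemma subspace_inner_norm x : subspace_inner x x = `|x| ^+ 2.
Proof. exact: inner_norm. Qed.

HB.instance Definition _ := CompleteNormedModule_isHilbert.Build R subspace_of
  subspace_inner_norm.

Lemma embed_subproof : val \in @bop_pred R subspace_of H.
Proof.
apply/asboolP; split; first exact: subspace_val_linear.
by exists 1 => x; rewrite mul1r.
Qed.

Definition embed : 'L(subspace_of, H) := Bop embed_subproof.

End Subspace.

Section Pencil.
Variables (R : realType) (H : hilbertType R).
Variables (M0 M1 : 'L(H, H)).

Definition pencil (z : R[i]) : 'L(H, H) := z *: M0 + M1.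

Definition regular_pencil := exists nu : R,
  (forall z, nu < complex.Re z -> boundedly_invertible (pencil z)) /\
  [bounded binv (pencil z) | z in [set z : R[i] | nu < complex.Re z]].

Definition IV : set H := [set x | range M0 (M1 x)].

Lemma bop_continuous (E F : normedModType R[i]) (T : 'L(E, F)) : continuous T.
Proof.
apply: bounded_linear_continuous; apply/linear_boundedP.
have [C C0 hC] := bop_bounded_ge0 T; exists C%:C.
by split=> [|r Cr x]; rewrite ?ger0_real ?ler0c// (le_trans (hC x))//
  ler_wpM2r// ltW.
Qed.

Lemma range_submod : subsemimod_closed [pred x | x \in range M0].
Proof.
split; first split.
- by rewrite inE /=; exists 0; rewrite ?linear0.
- by move=> _ _ /set_mem[x _ <-] /set_mem[y _ <-]; rewrite inE /=;
    exists (x + y); rewrite ?linearD.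
- by move=> a _ /set_mem[x _ <-]; rewrite inE /=;
    exists (a *: x); rewrite ?linearZ.
Qed.

Lemma IV_submod : subsemimod_closed [pred x | x \in IV].
Proof.
have [[r0 rD] rZ] := range_submod.
have IVE x : (x \in [pred x | x \in IV]) = (M1 x \in [pred x | x \in range M0]).
  by apply/idP/idP => /set_mem ?; apply/mem_set.
split; first split.
- by rewrite IVE linear0.
- by move=> x y; rewrite !IVE linearD => ? ?; apply: rD.
- by move=> a x; rewrite !IVE linearZ => ?; apply: rZ.
Qed.

Lemma IV_closed : closed (range M0) -> closed IV.
Proof.
by move=> cl; apply: (@preimage_closed _ _ M1) => // x _; exact: bop_continuous.
Qed.

Definition range_csub (cl : closed (range M0)) : closedSubspace H :=
  ClosedSubspace range_submod cl.

Definition IV_csub (cl : closed (range M0)) : closedSubspace H :=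
  ClosedSubspace IV_submod (IV_closed cl).

(* iota_{R(M0)}^* M iota_IV, embed S being the embedding iota_S of S *)
Definition compress (cl : closed (range M0)) (M : 'L(H, H)) :
    'L(subspace_of (IV_csub cl), subspace_of (range_csub cl)) :=
  bcomp (adjoint (embed (range_csub cl))) (bcomp M (embed (IV_csub cl))).

(* The time t is real whereas H only carries complex scalars, so the derivative
   is written out as the limit of the difference quotient. *)
Definition is_derivative (u : R -> H) (t : R) (du : H) :=
  (fun h : R => (h^-1)%:C *: (u (h + t) - u t)) @ 0^' --> du.

(* Functions on [0, +oo[ are represented by functions on R, only the values on
   [0, +oo[ of which are considered. *)
Definition ivp_solution (u0 : H) (u : R -> H) :=
  [/\ {within `[0, +oo[, continuous u},
      u 0 = u0 &
      exists du : R -> H,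
        [/\ forall t, 0 < t -> is_derivative u t (du t),
            {within `]0, +oo[, continuous du} &
            forall t, 0 < t -> M0 (du t) + M1 (u t) = 0]].

End Pencil.

(* Main.v *)
Require Import Defs.
From HB Require Import structures.
From mathcomp Require Import all_boot all_order all_algebra.
From mathcomp Require Import all_classical all_reals all_analysis.
From mathcomp Require Import complex ring lra.
Set Implicit Arguments.
Unset Strict Implicit.
Unset Printing Implicit Defensive.

Import Order.TTheory GRing.Theory Num.Theory.
Import numFieldNormedType.Exports.

Local Open Scope classical_set_scope.
Local Open Scope ring_scope.
Local Open Scope complex_scope.

(** The pencil controls the initial value space as follows. Let
    Q r = (r M0 + M1)^-1 for large real r. Since r Q r M0 x = x - Q r M1 x, the
    family r Q r is bounded at each point of the Hilbert space R(M0), hence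
    bounded in operator norm there by the uniform boundedness principle: for
    some K, the norm of Q r y is at most K / r times the norm of y, for every
    y in R(M0) ([rescaled_resolvents]).

    This one estimate makes M0 : IV -> R(M0) boundedly invertible. If x is in
    IV, then M1 x is in R(M0), so in x = r Q r M0 x + Q r M1 x the last term is
    O(1/r), and letting r tend to infinity bounds the norm of x by K times
    that of M0 x ([M0_bounded_below]). If y is in R(M0), then the points
    r Q r y lie in IV and M0 (r Q r y) = y - M1 Q r y tends to y; the lower
    bound makes them Cauchy, and their limit is a preimage of y in IV
    ([M0_IV_surjective]). The compressions of M0 and M1 agree with M0 and M1 on
    IV because the adjoint of the embedding of a closed subspace is the
    orthogonal projection ([adjoint_embedP], [adjoint_embedK]).

    With B = M0^-1 M1 on IV, the equation becomes u' = - B u, with a bounded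
    generator. The exponential series converges in operator norm and may be
    differentiated, with an O(h^2) remainder ([bexp_remainder]), so
    exp (- t B) u0 is a solution. Conversely, the equation forces every
    solution v into IV at positive times, hence also its derivative, IV being
    closed; so v' = - B v, and two solutions differ by a function that
    Gronwall's inequality annihilates ([solution_ode], [gronwall]). *)

(** * Real-valued norms *)

Section RealNorm.
Variables (R : realType) (E : normedModType R[i]).
Implicit Types (x y z : E) (r : R) (c : R[i]).

(** Norms take values in R[i]; real norms give access to the order of R, which
    is total. *)
Definition rnorm x : R := complex.Re `|x|.

Lemma rnormE x : `|x| = (rnorm x)%:C.
Proof. by rewrite RRe_real ?normr_real. Qed.

Lemma rnorm_ge0 x : 0 <= rnorm x.
Proof. by rewrite -ler0c -rnormE. Qed.

Lemma rnorm_le x r : (`|x| <= r%:C) = (rnorm x <= r).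
Proof. by rewrite rnormE lecR. Qed.

Lemma rnormD x y : rnorm (x + y) <= rnorm x + rnorm y.
Proof. by rewrite -lecR rmorphD/= -!rnormE ler_normD. Qed.

Lemma rnormN x : rnorm (- x) = rnorm x.
Proof. by rewrite /rnorm normrN. Qed.

Lemma rnormB x y : rnorm (x - y) <= rnorm x + rnorm y.
Proof. by rewrite -(rnormN y) rnormD. Qed.

Lemma rnorm_sym x y : rnorm (x - y) = rnorm (y - x).
Proof. by rewrite -rnormN opprB. Qed.

Lemma rnorm_tri y x z : rnorm (x - z) <= rnorm (x - y) + rnorm (y - z).
Proof. by rewrite -[x - z](subrKA y) rnormD. Qed.

Lemma rnorm0 : rnorm (0 : E) = 0.
Proof. by rewrite /rnorm normr0. Qed.

Lemma rnorm0_eq0 x : rnorm x = 0 -> x = 0.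
Proof. by move=> x0; apply: normr0_eq0; rewrite rnormE x0. Qed.

Lemma rnorm_gt0 x : (0 < rnorm x) = (x != 0).
Proof. by rewrite -ltcR -rnormE normr_gt0. Qed.

Lemma normcR r : `|r%:C| = `|r|%:C.
Proof. by rewrite normc_def/= expr0n addr0 sqrtr_sqr. Qed.

Lemma rnormZc c x : rnorm (c *: x) = complex.Re `|c| * rnorm x.
Proof.
by apply: (@complexI R); rewrite rmorphM/= -!rnormE normrZ.
Qed.

Lemma rnormZ r x : rnorm (r%:C *: x) = `|r| * rnorm x.
Proof. by rewrite rnormZc normcR. Qed.

Lemma rnorm_le_eps x : (forall e, 0 < e -> rnorm x <= e) -> x = 0.
Proof.
move=> x0; apply: rnorm0_eq0; apply/eqP; rewrite eq_le rnorm_ge0 andbT.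
by apply/ler_addgt0Pl => e e0; rewrite addr0 x0.
Qed.

Lemma cvg_rnormP {T : Type} {F : set_system T} {FF : Filter F} (u : T -> E) x :
  u @ F --> x <-> forall e, 0 < e -> \forall t \near F, rnorm (u t - x) <= e.
Proof.
split=> [/cvgrPdist_le ux e e0|ux].
  have := ux e%:C; rewrite ltcR => /(_ e0); apply: filterS => t.
  by rewrite rnorm_le rnorm_sym.
apply/cvgrPdist_le => e e0.
have eE : e = (complex.Re e)%:C by rewrite RRe_real// gtr0_real.
have /ux : 0 < complex.Re e by rewrite -ltcR -eE.
by apply: filterS => t ute; rewrite eE rnorm_le rnorm_sym.
Qed.

End RealNorm.

(** * Completeness and uniform boundedness *)

Section CompleteModulus.
Variables (R : realType) (E : completeNormedModType R[i]).

(** Cauchy's criterion, keeping the modulus of convergence as an error bound. *)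
Lemma cvg_modulus (u : nat -> E) (a : nat -> R) :
  (forall n m, (n <= m)%N -> rnorm (u m - u n) <= a n) ->
  (forall e, 0 < e -> exists n, a n <= e) ->
  exists2 l, u @ \oo --> l & forall n, rnorm (l - u n) <= a n.
Proof.
move=> ua a0.
have /cauchy_cvg/cvg_ex[l ul] : cauchy (u @ \oo).
  apply/cauchy_exP => e e0.
  have eE : e = (complex.Re e)%:C by rewrite RRe_real// gtr0_real.
  have [|n an] := a0 (complex.Re e / 2).
    by rewrite divr_gt0// -ltcR -eE.
  exists (u n); exists n => // m /= nm; rewrite -ball_normE/=.
  rewrite eE rnormE ltcR rnorm_sym (le_lt_trans (ua _ _ nm))//.
  by rewrite (le_lt_trans an)// ltr_pdivrMr// ltr_pMr ?ltr1n// -ltcR -eE.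
exists l => // n; apply/ler_addgt0Pl => e e0.
have /cvg_rnormP/(_ _ e0)[N _ uN] := ul.
have := uN (maxn n N) (leq_maxr _ _); have := ua n (maxn n N) (leq_maxl _ _).
move=> h1 h2; rewrite (le_trans (rnorm_tri (u (maxn n N)) _ _))//.
by rewrite lerD// rnorm_sym.
Qed.

End CompleteModulus.

Section BoundedOp.
Variables (R : realType) (E F : normedModType R[i]).
Implicit Types T : 'L(E, F).

Lemma rnorm_bop T x : rnorm (T x) <= rnorm T * rnorm x.
Proof. by rewrite -lecR rmorphM/= -!rnormE; exact: opnorm_bound. Qed.

Lemma rnorm_bop_le T (c : R) :
  0 <= c -> (forall x, rnorm (T x) <= c * rnorm x) -> rnorm T <= c.
Proof.
move=> c0 Tc; rewrite -rnorm_le; apply: opnorm_le; first by rewrite ler0c.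
by move=> x; rewrite !rnormE -rmorphM lecR.
Qed.

Lemma bop_of_bound (f : E -> F) (c : R) :
  linear f -> (forall x, rnorm (f x) <= c * rnorm x) ->
  exists T : 'L(E, F), T =1 f.
Proof.
move=> lf fc; have fb : f \in @bop_pred R E F.
  apply/asboolP; split=> //; exists c%:C => x.
  by rewrite !rnormE -rmorphM lecR.
by exists (Bop fb).
Qed.

End BoundedOp.

Section UniformBoundedness.
Variables (R : realType) (E : completeNormedModType R[i]) (F : normedModType R[i]).
Variables (I : Type) (T : I -> 'L(E, F)).

(** The operators are linear, so T z is half the difference of the values at
    x + z and x - z, and scaling reaches every vector. *)
Lemma ball_bound (x : E) (r K : R) : 0 < r ->
  (forall i y, rnorm (y - x) <= r -> rnorm (T i y) <= K) ->
  forall i y, rnorm (T i y) <= K / r * rnorm y.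
Proof.
move=> r0 TK i y; have [->|y0] := eqVneq y 0.
  by rewrite linear0 !rnorm0 mulr0.
have ny : 0 < rnorm y by rewrite rnorm_gt0.
set z := (r / rnorm y)%:C *: y.
have nz : rnorm z = r.
  by rewrite rnormZ ger0_norm ?divr_ge0 ?ltW// divfK// gt_eqF.
have h1 : rnorm (T i (x + z)) <= K by apply: TK; rewrite addrAC subrr add0r nz.
have h2 : rnorm (T i (x - z)) <= K.
  by apply: TK; rewrite addrAC subrr add0r rnormN nz.
have : rnorm (2%:C *: T i z) <= K + K.
  rewrite (_ : _ *: _ = T i (x + z) - T i (x - z)).
    exact: le_trans (rnormB _ _) (lerD _ _).
  rewrite linearD linearB opprB addrC subrKA.
  by rewrite rmorph_nat scaler_nat mulr2n.
rewrite rnormZ /z linearZ/= rnormZ ger0_norm// [`|r / _|]ger0_norm; last first.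
  by rewrite divr_ge0// ltW.
move=> h; have {}h : r / rnorm y * rnorm (T i y) <= K by lra.
by rewrite mulrAC ler_pdivlMr// mulrC -ler_pdivrMr// mulrAC.
Qed.

(** The Banach-Steinhaus theorem. If no bound were uniform, then no ball would
    carry one by [ball_bound], and one could choose nested balls, the n-th of
    which consists of points y with n < rnorm (T i y) for some i; no pointwise
    bound holds at their common point. *)
Lemma uniform_boundedness :
  (forall x, exists K, forall i, rnorm (T i x) <= K) ->
  exists K, forall i x, rnorm (T i x) <= K * rnorm x.
Proof.
move=> Tpt; apply: contrapT => Tunb.
have unb_ball (x : E) (r : R) n : 0 < r ->
    exists i y, rnorm (y - x) <= r /\ n < rnorm (T i y).
  move=> r0; apply: contrapT => nTb; apply: Tunb; exists (n / r).
  apply: (@ball_bound x) => // i y yx; rewrite leNgt; apply/negP => nT.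
  by apply: nTb; exists i, y.
have step (p : E * R) (n : nat) : exists q : E * R, 0 < p.2 ->
  [/\ 0 < q.2, q.2 <= p.2 / 2, rnorm (q.1 - p.1) + q.2 <= p.2 &
      exists i, forall y, rnorm (y - q.1) <= q.2 -> n%:R < rnorm (T i y)].
  have [p0|] := ltP 0 p.2; last by move=> _; exists p.
  have p20 : 0 < p.2 / 2 by rewrite divr_gt0.
  have [i [y [yx ny]]] := unb_ball p.1 (p.2 / 2) n%:R p20.
  have d0 : 0 < rnorm (T i y) - n%:R by rewrite subr_gt0.
  set d := rnorm (T i y) - n%:R in d0.
  (* Adding 1 keeps the divisor k of the new radius positive. *)
  set k := rnorm (T i) + 1.
  have k0 : 0 < k by rewrite ltr_wpDl ?rnorm_ge0.
  exists (y, Num.min (p.2 / 2) (d / 2 / k)) => _ /=.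
  have m1 : Num.min (p.2 / 2) (d / 2 / k) <= p.2 / 2 by rewrite ge_min lexx.
  have m2 : Num.min (p.2 / 2) (d / 2 / k) <= d / 2 / k.
    by rewrite ge_min lexx orbT.
  split => //; first by rewrite lt_min p20 !divr_gt0.
    by rewrite (le_trans (lerD yx m1))// -splitr.
  exists i => w wy.
  have Tw : rnorm (T i (y - w)) <= d / 2.
    rewrite (le_trans (rnorm_bop _ _))//.
    rewrite (@le_trans _ _ (k * (d / 2 / k)))//; last first.
      by rewrite mulrC divfK// gt_eqF.
    rewrite ler_pM ?rnorm_ge0//; first by rewrite lerDl.
    by rewrite rnorm_sym (le_trans wy).
  have := rnorm_tri (T i w) (T i y) 0; rewrite !subr0 -linearB => tri.
  rewrite /d in Tw d0; lra.
have [g gP] := choice (fun pn : (E * R) * nat => step pn.1 pn.2).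
(* A pair stands for the ball of center s.1 and radius s.2. *)
pose s := fix s n := if n is m.+1 then g (s m, m) else (0, 1) : E * R.
have s0 n : 0 < (s n).2.
  by elim: n => //= n IH; have [] := gP (s n, n) IH.
have sS n : (s n.+1).2 <= (s n).2 / 2.
  by have [] := gP (s n, n) (s0 n).
have sD n : rnorm ((s n.+1).1 - (s n).1) + (s n.+1).2 <= (s n).2.
  by have [] := gP (s n, n) (s0 n).
have sT n : exists i, forall y, rnorm (y - (s n.+1).1) <= (s n.+1).2 ->
    n%:R < rnorm (T i y).
  by have [] := gP (s n, n) (s0 n).
have nested n m : (n <= m)%N ->
    rnorm ((s m).1 - (s n).1) + (s m).2 <= (s n).2.
  move=> /subnK <-; elim: (m - n)%N => [|k IH].
    by rewrite add0n subrr rnorm0 add0r.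
  have := rnorm_tri (s (k + n)%N).1 (s (k.+1 + n)%N).1 (s n).1.
  have := sD (k + n)%N; move: IH; rewrite -addSn; lra.
have small n : (s n).2 <= n.+1%:R^-1.
  elim: n => [|n IH]; first by rewrite invr1.
  rewrite (le_trans (sS n))// (le_trans (ler_wpM2r _ IH))//.
  rewrite -invfM lef_pV2 ?posrE ?mulr_gt0//.
  by rewrite -natrM ler_nat muln2 -addnn -[n.+2]addn1 leq_add2l.
have [||l _ lP] := @cvg_modulus _ _ (fun n => (s n).1) (fun n => (s n).2).
- move=> n m nm; rewrite (le_trans _ (nested _ _ nm))// lerDl.
  exact: ltW.
- move=> e e0; exists (Num.trunc e^-1); rewrite (le_trans (small _))//.
  rewrite invf_ple ?posrE//.
  by rewrite ltW// truncnS_gt.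
have [K KP] := Tpt l.
have [i iP] := sT (Num.trunc K).+1.
have /iP := lP (Num.trunc K).+2.
rewrite ltNge (le_trans (KP i))// ltW//.
exact: truncnS_gt.
Qed.

End UniformBoundedness.

(** * Limits of bounded operators *)

Lemma rnorm_cvg_le (R : realType) (E : normedModType R[i]) (u : nat -> E) x
    (M : R) :
  u @ \oo --> x -> (forall n, rnorm (u n) <= M) -> rnorm x <= M.
Proof.
move=> /cvg_rnormP ux uM; apply/ler_addgt0Pl => e /ux[N _ uN].
rewrite -(subr0 x) (le_trans (rnorm_tri (u N) _ _))// lerD ?subr0//.
by rewrite rnorm_sym uN/=.
Qed.

Lemma rnorm_sum (R : realType) (E : normedModType R[i]) n (u : 'I_n -> E) :
  rnorm (\sum_(i < n) u i) <= \sum_(i < n) rnorm (u i).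
Proof.
elim/big_rec2 : _ => [|i x y _ xy]; first by rewrite rnorm0.
by rewrite (le_trans (rnormD _ _))// lerD2l.
Qed.

Section OperatorCompleteness.
Variables (R : realType) (E : normedModType R[i]) (F : completeNormedModType R[i]).

(** Pointwise limits exist because F is complete, and they inherit the modulus
    of convergence uniformly on the unit ball. *)
Lemma bop_cvg_modulus (T : nat -> 'L(E, F)) (a : nat -> R) :
  (forall n m, (n <= m)%N -> rnorm (T m - T n) <= a n) ->
  (forall e, 0 < e -> exists n, a n <= e) ->
  exists2 L, T @ \oo --> L & forall n, rnorm (L - T n) <= a n.
Proof.
move=> Ta a0.
have age0 n : 0 <= a n by apply: le_trans (Ta n n (leqnn n)); exact: rnorm_ge0.
have Tx x n m : (n <= m)%N -> rnorm (T m x - T n x) <= a n * rnorm x.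
  move=> nm; rewrite (le_trans (rnorm_bop (T m - T n) x))//.
  by rewrite ler_wpM2r ?rnorm_ge0// Ta.
have small c e : 0 <= c -> 0 < e -> exists n, a n * c <= e.
  move=> c0 e0; have [n an] := a0 (e / (c + 1)) (divr_gt0 e0 (ltr_wpDl c0 ltr01)).
  exists n; rewrite (@le_trans _ _ (a n * (c + 1)))//.
    by rewrite ler_wpM2l// lerDl.
  by rewrite -ler_pdivlMr// ltr_wpDl.
have lim_ex x : exists l, forall n, rnorm (l - T n x) <= a n * rnorm x.
  have [||l _ ?] := @cvg_modulus _ _ (T ^~ x) (fun n => a n * rnorm x).
  - exact: Tx.
  - by move=> e; apply: small; exact: rnorm_ge0.
  - by exists l.
have [L LP] := choice lim_ex.
have Llin : linear L.
  move=> c x y; apply/eqP; rewrite -subr_eq0; apply/eqP/rnorm_le_eps => e e0.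
  set K := rnorm (c *: x + y) + complex.Re `|c| * rnorm x + rnorm y.
  have cge0 : 0 <= complex.Re `|c| by rewrite -ler0c RRe_real ?normr_real.
  have K0 : 0 <= K by rewrite !addr_ge0 ?mulr_ge0 ?rnorm_ge0.
  have [n an] := small K e K0 e0; apply: le_trans an.
  have -> : L (c *: x + y) - (c *: L x + L y) =
      (L (c *: x + y) - T n (c *: x + y)) - c *: (L x - T n x) - (L y - T n y).
    rewrite -addrA -opprD scalerBr addrACA -opprD -(linearP (T n)).
    by rewrite opprB addrA subrK.
  rewrite (le_trans (rnormB _ _))// /K !mulrDr lerD ?LP//.
  rewrite (le_trans (rnormB _ _))// lerD ?LP//.
  by rewrite rnormZc mulrCA ler_wpM2l ?LP.
have Lbnd x : rnorm (L x) <= (a 0%N + rnorm (T 0%N)) * rnorm x.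
  rewrite -(subrK (T 0%N x) (L x)) (le_trans (rnormD _ _))//.
  by rewrite mulrDl lerD ?LP ?rnorm_bop.
have [S SL] := bop_of_bound Llin Lbnd.
have ST n : rnorm (S - T n) <= a n.
  apply: rnorm_bop_le => // x.
  by rewrite -[(S - T n) x]/(S x - T n x) SL LP.
exists S => //; apply/cvg_rnormP => e e0.
have [n an] := a0 (e / 2) (divr_gt0 e0 (ltr0n _ 2)).
exists n => // m /= nm; rewrite (le_trans (rnorm_tri (T n) _ _))//.
by rewrite [e]splitr lerD ?(le_trans (Ta _ _ nm))// rnorm_sym (le_trans (ST n)).
Qed.

End OperatorCompleteness.

Section CompositionAlgebra.
Variables (R : realType) (E F G : normedModType R[i]).
Implicit Types (S : 'L(F, G)) (T : 'L(E, F)).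

Lemma bcompDr S T T' : bcomp S (T + T') = bcomp S T + bcomp S T'.
Proof. by apply: bop_ext => x; rewrite /= linearD. Qed.

Lemma bcompBr S T T' : bcomp S (T - T') = bcomp S T - bcomp S T'.
Proof. by apply: bop_ext => x; rewrite /= linearB. Qed.

Lemma bcompZr S c T : bcomp S (c *: T) = c *: bcomp S T.
Proof. by apply: bop_ext => x; rewrite /= linearZ. Qed.

Lemma bcompZl S c T : bcomp (c *: S) T = c *: bcomp S T.
Proof. exact: bop_ext. Qed.

Lemma bcomp0r S : bcomp S (0 : 'L(E, F)) = 0.
Proof. by apply: bop_ext => x; rewrite /= linear0. Qed.

Lemma rnorm_bcomp S T : rnorm (bcomp S T) <= rnorm S * rnorm T.
Proof.
apply: rnorm_bop_le => [|x]; first by rewrite mulr_ge0 ?rnorm_ge0.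
rewrite -mulrA (le_trans (rnorm_bop S (T x)))//.
by rewrite ler_wpM2l ?rnorm_ge0 ?rnorm_bop.
Qed.

Lemma rnorm_bid : rnorm (bid E) <= 1.
Proof. by apply: rnorm_bop_le => // x; rewrite mul1r. Qed.

End CompositionAlgebra.

Lemma rnorm_bpow (R : realType) (E : normedModType R[i]) (A : 'L(E, E)) n :
  rnorm (bpow A n) <= rnorm A ^+ n.
Proof.
elim: n => [|n IH]; first exact: rnorm_bid.
rewrite exprS (le_trans (rnorm_bcomp _ _))//.
by rewrite ler_wpM2l ?rnorm_ge0.
Qed.

Lemma bpowZ (R : realType) (E : normedModType R[i]) (A : 'L(E, E)) c n :
  bpow (c *: A) n = c ^+ n *: bpow A n.
Proof.
elim: n => [|n IH]; first by rewrite scale1r.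
by rewrite /bpow/= -!/(bpow _ _) IH bcompZl bcompZr scalerA exprS.
Qed.

(** * The exponential of a bounded operator *)

(** Taylor's formula for monomials with a remainder that is summable against
    the exponential series. The induction on n absorbs the term
    n h^2 t^(n-1), which [derivK] bounds by h^2 K^n, thanks to the extra 1
    in K. *)
Lemma monomial_remainder (R : realType) (t h K : R) n :
  `|t| + `|h| + 1 <= K ->
  `|(t + h) ^+ n - t ^+ n - h * (n%:R * t ^+ n.-1)| <= h ^+ 2 * K ^+ n.
Proof.
move=> tK; have [t0 h0] : 0 <= `|t| /\ 0 <= `|h| by [].
have K0 : 0 <= K by lra.
have derivK m : m%:R * `|t| ^+ m.-1 <= K ^+ m.
  elim: m => [|m IH]; first by rewrite mul0r.
  have tm : `|t| ^+ m <= K ^+ m by rewrite lerXn2r ?nnegrE//; lra.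
  have mE : m%:R * `|t| ^+ m = `|t| * (m%:R * `|t| ^+ m.-1).
    by case: (m) => [|k]; rewrite ?mul0r ?mulr0// exprS mulrCA.
  rewrite /= -natr1 mulrDl mul1r mE exprS.
  have h1 : `|t| * (m%:R * `|t| ^+ m.-1) <= `|t| * K ^+ m by rewrite ler_wpM2l.
  have h2 : (`|t| + 1) * K ^+ m <= K * K ^+ m.
    by rewrite ler_wpM2r ?exprn_ge0//; lra.
  lra.
elim: n => [|n IH].
  by rewrite !expr0 subrr mul0r mulr0 subrr normr0 mulr1 sqr_ge0.
have -> : (t + h) ^+ n.+1 - t ^+ n.+1 - h * (n.+1%:R * t ^+ n.+1.-1) =
    (t + h) * ((t + h) ^+ n - t ^+ n - h * (n%:R * t ^+ n.-1)) +
    h ^+ 2 * (n%:R * t ^+ n.-1).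
  by case: n {IH} => [|n] /=; rewrite ?exprS -?natr1; ring.
rewrite (le_trans (ler_normD _ _))//.
have h1 : `|(t + h) * ((t + h) ^+ n - t ^+ n - h * (n%:R * t ^+ n.-1))| <=
    (K - 1) * (h ^+ 2 * K ^+ n).
  rewrite normrM ler_pM// (le_trans (ler_normD _ _))//; lra.
have h2 : `|h ^+ 2 * (n%:R * t ^+ n.-1)| <= h ^+ 2 * K ^+ n.
  rewrite normrM ger0_norm ?sqr_ge0// ler_wpM2l ?sqr_ge0//.
  by rewrite normrM normr_nat normrX derivK.
rewrite [K ^+ n.+1]exprS; lra.
Qed.

Section ExponentialPartialSums.
Variables (R : realType) (E : completeNormedModType R[i]) (A : 'L(E, E)).
Implicit Types (t h : R) (n : nat).

Lemma exp_coeff_series_le (c : R) n :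
  0 <= c -> \sum_(i < n) exp_coeff c i <= expR c.
Proof.
move=> c0; rewrite -(big_mkord xpredT (exp_coeff c)).
apply: (nondecreasing_cvgn_le _ (is_cvg_series_exp_coeff c) n).
by apply: nondecreasing_series => k _ _; exact: exp_coeff_ge0.
Qed.

Definition exp_sum t n : 'L(E, E) :=
  \sum_(i < n) (t ^+ i / i`!%:R)%:C *: bpow A i.

Lemma exp_sumE t :
  series (fun n => (n`!%:R : R[i])^-1 *: bpow (t%:C *: A) n) = exp_sum t.
Proof.
apply/funext => n; rewrite /series/= big_mkord; apply: eq_bigr => i _.
by rewrite bpowZ scalerA mulrC fmorph_div/= rmorphXn rmorph_nat.
Qed.

Lemma rnorm_exp_sum_tail t n m : (n <= m)%N ->
  rnorm (exp_sum t m - exp_sum t n) <=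
  \sum_(i < m) exp_coeff (`|t| * rnorm A) i -
  \sum_(i < n) exp_coeff (`|t| * rnorm A) i.
Proof.
move=> /subnK <-; elim: (m - n)%N => [|k IH].
  by rewrite add0n !subrr rnorm0.
rewrite addSn /exp_sum !big_ord_recr/= -/(exp_sum _ _) -/(exp_sum _ _).
rewrite addrAC [leRHS]addrAC (le_trans (rnormD _ _))// lerD//.
rewrite rnormZ exp_coeffE normrM normfV normr_nat normrX exprMn/=.
by rewrite [leRHS]mulrA [_^-1 * _]mulrC ler_wpM2l ?rnorm_bpow ?mulr_ge0.
Qed.

(** The real exponential series dominates the operator series. *)
Lemma exp_sum_cvg t : exp_sum t @ \oo --> bexp (t%:C *: A).
Proof.
set c := `|t| * rnorm A.
have c0 : 0 <= c by rewrite mulr_ge0 ?rnorm_ge0.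
have [||L SL _] := @bop_cvg_modulus _ _ _ (exp_sum t)
    (fun n => expR c - \sum_(i < n) exp_coeff c i).
- move=> n m nm; rewrite (le_trans (rnorm_exp_sum_tail t nm))//.
  by rewrite lerD2r exp_coeff_series_le.
- move=> e e0; have /cvgrPdist_le/(_ e e0)[N _ /(_ N (leqnn N))] :=
    is_cvg_series_exp_coeff c.
  rewrite -/(expR c) /series/= big_mkord => h; exists N.
  by rewrite (le_trans (ler_norm _)).
rewrite /bexp exp_sumE.
by have /(cvg_lim (@norm_hausdorff _ _)) -> := SL.
Qed.

Lemma bexp0 : bexp ((0 : R)%:C *: A) = bid E.
Proof.
have e0 : exp_sum 0 @ \oo --> bid E.
  apply/cvg_rnormP => e e0; exists 1%N => // -[//|n] _ /=.
  rewrite /exp_sum big_ord_recl expr0 divr1 scale1r big1 ?addr0 ?subrr ?rnorm0//.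
    exact: ltW.
  by move=> i _; rewrite expr0n/= mul0r scale0r.
by rewrite -(cvg_lim (@norm_hausdorff _ _) (@exp_sum_cvg 0)) (cvg_lim (@norm_hausdorff _ _) e0).
Qed.

(** Composition with A shifts the series by one, that is, differentiates its
    coefficients. *)
Lemma bcomp_exp_sum t n : bcomp A (exp_sum t n) =
  \sum_(i < n.+1) (i%:R * t ^+ i.-1 / i`!%:R)%:C *: bpow A i.
Proof.
elim: n => [|n IH].
  by rewrite /exp_sum big_ord0 bcomp0r big_ord_recl big_ord0 !mul0r scale0r addr0.
rewrite /exp_sum big_ord_recr/= bcompDr -/(exp_sum _ _) IH bcompZr.
rewrite [RHS]big_ord_recr/=; congr (_ + _%:C *: _).
by rewrite factS natrM invfM mulrACA divff ?mul1r.
Qed.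

(** The exponential is differentiable in operator norm: [monomial_remainder]
    bounds each term of the partial sums, and the bounds sum up to a partial
    sum of a real exponential. *)
Lemma bexp_remainder t h : `|h| <= 1 ->
  rnorm (bexp ((t + h)%:C *: A) - bexp (t%:C *: A)
         - h%:C *: bcomp A (bexp (t%:C *: A)))
  <= h ^+ 2 * expR ((`|t| + 2) * rnorm A).
Proof.
move=> h1; set K := `|t| + 2.
have K0 : 0 <= K by rewrite addr_ge0.
apply: (@rnorm_cvg_le _ _ (fun n => exp_sum (t + h) n.+1 - exp_sum t n.+1
    - h%:C *: bcomp A (exp_sum t n))).
  apply: cvgB; first apply: cvgB.
  - by rewrite (cvg_shiftS (exp_sum (t + h))); exact: exp_sum_cvg.
  - by rewrite (cvg_shiftS (exp_sum t)); exact: exp_sum_cvg.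
  apply: cvgZr; apply/cvg_rnormP => e e0.
  have b0 : 0 < rnorm A + 1 by rewrite ltr_wpDl ?rnorm_ge0.
  have /cvg_rnormP/(_ _ (divr_gt0 e0 b0)) := @exp_sum_cvg t.
  apply: filterS => n; rewrite ler_pdivlMr// -bcompBr => h2.
  rewrite (le_trans (rnorm_bcomp _ _))// mulrC.
  by rewrite (le_trans _ h2)// ler_wpM2l ?rnorm_ge0// lerDl.
move=> n; rewrite bcomp_exp_sum /exp_sum -sumrB scaler_sumr -sumrB.
rewrite (le_trans (rnorm_sum _))//.
rewrite (le_trans _ (ler_wpM2l (sqr_ge0 h) (@exp_coeff_series_le (K * rnorm A) n.+1 _)))//;
  last by rewrite mulr_ge0 ?rnorm_ge0.
rewrite mulr_sumr; apply: ler_sum => i _.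
rewrite scalerA -!scalerBl -rmorphM -!rmorphB rnormZ exp_coeffE exprMn.
rewrite (mulrA h) -!mulrBl normrM normfV normr_nat.
rewrite [leRHS](_ : _ = h ^+ 2 * K ^+ i / i`!%:R * rnorm A ^+ i); last first.
  by rewrite [_^-1 * _]mulrC !mulrA mulrAC.
rewrite ler_pM ?rnorm_ge0 ?rnorm_bpow ?mulr_ge0//.
rewrite ler_wpM2r// monomial_remainder//; rewrite /K; lra.
Qed.

End ExponentialPartialSums.

(** * Orthogonal projections in a Hilbert space *)

Section Inner.
Variables (R : realType) (H : hilbertType R).
Implicit Types (x y v : H).

Lemma innerxx x : inner x x = (rnorm x ^+ 2)%:C.
Proof. by rewrite inner_norm rnormE rmorphXn. Qed.

Lemma innerC x y : inner x y = Num.conj (inner y x).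
Proof. by rewrite [LHS](hermC (@inner R H)) expr0 mul1r. Qed.

Definition rinner x y : R := complex.Re `|inner x y|.

Lemma rinnerE x y : `|inner x y| = (rinner x y)%:C.
Proof. by rewrite RRe_real ?normr_real. Qed.

Lemma rinner_ge0 x y : 0 <= rinner x y.
Proof. by rewrite -ler0c -rinnerE. Qed.

Lemma rinnerDl x x' y : rinner (x + x') y <= rinner x y + rinner x' y.
Proof. by rewrite -lecR rmorphD/= -!rinnerE linearDl ler_normD. Qed.

Lemma rinnerNl x y : rinner (- x) y = rinner x y.
Proof. by rewrite /rinner linearNl normrN. Qed.

(** The point of the line spanned by x that is closest to v has coefficient
    <v, x> / <x, x>; Cauchy-Schwarz and the projection theorem both follow from
    the value of the distance. *)
Lemma line_distance v x : x != 0 ->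
  exists c : R[i],
    rnorm (v - c *: x) ^+ 2 = rnorm v ^+ 2 - (rinner v x / rnorm x) ^+ 2.
Proof.
move=> x0; have xx0 : inner x x != 0 by rewrite dnorm_eq0.
have xxc : Num.conj (inner x x) = inner x x.
  by rewrite conj_Creal// ger0_real// dnorm_ge0.
have xx_norm : `|inner x x| = inner x x by rewrite ger0_norm ?dnorm_ge0.
pose q := `|inner v x| ^+ 2 / inner x x.
have qc : Num.conj q = q.
  by rewrite conj_Creal// ger0_real// divr_ge0 ?dnorm_ge0// exprn_ge0.
exists (inner v x / inner x x).
have vx : inner v ((inner v x / inner x x) *: x) = q.
  by rewrite linearZr_LR/= rmorphM fmorphV/= xxc /q normCK mulrC mulrA.
have cx : inner ((inner v x / inner x x) *: x) ((inner v x / inner x x) *: x) = q.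
  by rewrite dnormZ normf_div xx_norm expr_div_n /q expr2 [(_ * inner x x)^-1]invfM mulrA divfK.
apply: (@complexI R); rewrite -innerxx dnormB vx cx qc.
rewrite opprD addrA addrK rmorphB/= -innerxx; congr (_ - _).
by rewrite rmorphXn rmorphM fmorphV/= exprMn -rinnerE exprVn /q innerxx rmorphXn.
Qed.

Lemma cauchy_schwarz x y : rinner x y <= rnorm x * rnorm y.
Proof.
have [->|y0] := eqVneq y 0; first by rewrite /rinner linear0r normr0 rnorm0 mulr0.
have ny : 0 < rnorm y by rewrite rnorm_gt0.
have [c cE] := line_distance x y0.
rewrite -ler_pdivrMr// -(@ler_pXn2r _ 2) ?nnegrE ?rnorm_ge0//.
  by rewrite -subr_ge0 -cE sqr_ge0.
by rewrite divr_ge0 ?rnorm_ge0 ?rinner_ge0.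
Qed.

End Inner.

Section Projection.
Variables (R : realType) (H : hilbertType R) (S : closedSubspace H).
Implicit Types (x y s : H).

Lemma csub0 : (S : set H) 0.
Proof. by have [[/set_mem]] := csub_submod S. Qed.

Lemma csubD x y : (S : set H) x -> (S : set H) y -> (S : set H) (x + y).
Proof.
have [[_ SD] _] := csub_submod S => Sx Sy.
by apply: set_mem; apply: SD; apply: mem_set.
Qed.

Lemma csubZ c x : (S : set H) x -> (S : set H) (c *: x).
Proof.
have [_ SZ] := csub_submod S => Sx.
by apply: set_mem; apply: SZ; apply: mem_set.
Qed.

Lemma csubB x y : (S : set H) x -> (S : set H) y -> (S : set H) (x - y).
Proof. by move=> Sx Sy; rewrite -scaleN1r; apply/csubD/csubZ. Qed.

Lemma csub_cvg {T : Type} {F : set_system T} {FF : ProperFilter F}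
    (u : T -> H) x :
  (\forall t \near F, (S : set H) (u t)) -> u @ F --> x -> (S : set H) x.
Proof.
by move=> Su ux; exact: (@closed_cvg _ _ F _ u (S : set H) (@csub_closed _ _ S) _ x).
Qed.

(** A point of S nearly minimizing the distance to y nearly is the orthogonal
    projection of y: otherwise moving along some x in S would come closer
    to y than the infimum. *)
Lemma almost_projection y (e : R) : 0 < e ->
  exists2 s, (S : set H) s &
    forall x, (S : set H) x -> rinner (y - s) x <= e * rnorm x.
Proof.
move=> e0; pose D := [set rnorm (y - s) ^+ 2 | s in (S : set H)].
have hD : has_inf D.
  split; first by exists (rnorm (y - 0) ^+ 2), 0 => //; exact: csub0.
  by exists 0 => _ [s _ <-]; exact: sqr_ge0.
have [_ [s Ss <-] sd] := inf_adherent (exprn_gt0 2 e0) hD.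
exists s => // x Sx; have [->|x0] := eqVneq x 0.
  by rewrite /rinner linear0r normr0 rnorm0 mulr0.
have nx : 0 < rnorm x by rewrite rnorm_gt0.
have [c cE] := line_distance (y - s) x0.
have : inf D <= rnorm (y - s - c *: x) ^+ 2.
  apply: ge_inf; first by have [] := hD.
  by exists (s + c *: x); [apply/csubD/csubZ|rewrite opprD addrA].
rewrite cE => dc; rewrite -ler_pdivrMr// -(@ler_pXn2r _ 2) ?nnegrE ?(ltW e0)//.
  lra.
by rewrite divr_ge0 ?rnorm_ge0 ?rinner_ge0.
Qed.

(** Almost projections s n of precision 1/(n+1) form a Cauchy sequence, as
    w = s m - s n is in S and <w, w> = <y - s n, w> - <y - s m, w>. *)
Lemma projection_ex y :
  exists2 p, (S : set H) p & forall x, (S : set H) x -> inner (y - p) x = 0.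
Proof.
have [s sP] : exists s : nat -> H, forall n, (S : set H) (s n) /\
    forall x, (S : set H) x -> rinner (y - s n) x <= n.+1%:R^-1 * rnorm x.
  have step n : exists p, (S : set H) p /\
      forall x, (S : set H) x -> rinner (y - p) x <= n.+1%:R^-1 * rnorm x.
    have n0 : 0 < n.+1%:R^-1 :> R by [].
    by have [p] := almost_projection y n0; exists p.
  by have [s sP] := choice step; exists s.
have sS n : (S : set H) (s n) by case: (sP n).
have [||p sp _] := @cvg_modulus _ _ s (fun n => 2 * n.+1%:R^-1).
- move=> n m nm; set w := s m - s n.
  have [->|w0] := eqVneq w 0; first by rewrite rnorm0 mulr_ge0.
  have nw : 0 < rnorm w by rewrite rnorm_gt0.
  have Sw : (S : set H) w by exact: csubB.
  have [_ /(_ w Sw) hn] := sP n; have [_ /(_ w Sw) hm] := sP m.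
  have mn : m.+1%:R^-1 <= n.+1%:R^-1 :> R by rewrite lef_pV2 ?posrE// ler_nat.
  rewrite -(ler_pM2r nw); have -> : rnorm w * rnorm w = rinner w w.
    by rewrite /rinner inner_norm normrX normr_id rnormE -rmorphXn expr2.
  rewrite [w in rinner w _](_ : _ = (y - s n) - (y - s m)); last first.
    by rewrite opprB addrC subrKA.
  rewrite (le_trans (rinnerDl _ _ _))// rinnerNl.
  move: hn hm (ler_wpM2r (ltW nw) mn); move: (n.+1%:R^-1 : R) (m.+1%:R^-1 : R).
  move=> a b hn hm ab; lra.
- move=> e e0; exists (Num.trunc (2 / e)).
  by rewrite ler_pdivrMr// mulrC -ler_pdivrMr// ltW// truncnS_gt.
exists p; first by apply: csub_cvg sp; exact: nearW.
move=> x Sx; apply: normr0_eq0; rewrite rinnerE; congr (_%:C).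
apply/eqP; rewrite eq_le rinner_ge0 andbT; apply/ler_addgt0Pl => e e0; rewrite addr0.
have [k k0 kx] : exists2 k, 0 < k & k * rnorm x <= e / 2.
  exists (e / (rnorm x + 1) / 2).
    by rewrite !divr_gt0// ltr_wpDl ?rnorm_ge0.
  rewrite mulrAC ler_wpM2r// mulrAC ler_pdivrMr ?ltr_wpDl ?rnorm_ge0//.
  by rewrite ler_wpM2l ?(ltW e0)// lerDl.
have /cvg_rnormP/(_ _ k0)[N _ Np] := sp.
pose n := maxn N (Num.trunc k^-1).
have h1 : rnorm (s n - p) <= k by apply: Np; exact: leq_maxl.
have h2 : n.+1%:R^-1 <= k.
  rewrite invf_ple ?posrE// (le_trans (ltW (truncnS_gt _)))//.
  by rewrite ler_nat ltnS leq_maxr.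
have [_ /(_ x Sx) h3] := sP n.
rewrite -(subrKA (s n)) (le_trans (rinnerDl _ _ _))//.
have h5 := ler_wpM2r (rnorm_ge0 x) h1; have h6 := ler_wpM2r (rnorm_ge0 x) h2.
have {}h3 := le_trans h3 h6.
have := cauchy_schwarz (s n - p) x; lra.
Qed.

Lemma subspace_in (x : subspace_of S) : (S : set H) (embed S x).
Proof. exact: set_mem (subspace_valP x). Qed.

Lemma subspace_orth0 (p : subspace_of S) :
  (forall x : subspace_of S, inner (embed S x) (embed S p) = 0) -> p = 0.
Proof.
by move=> /(_ p)/eqP; rewrite dnorm_eq0 => /eqP p0; apply: val_inj.
Qed.

(** The orthogonal projection onto S satisfies the condition that specifies
    the adjoint of the embedding of S, so that the adjoint does not take its
    default value. *)
Lemma adjoint_embedP (x : subspace_of S) (y : H) :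
  inner (embed S x) y = inner x (adjoint (embed S) y).
Proof.
have step z : exists p : subspace_of S,
    forall x : subspace_of S, inner (embed S x) z = inner (embed S x) (embed S p).
  have [p Sp pz] := projection_ex z; exists (SubspaceOf (mem_set Sp)) => w.
  apply/eqP; rewrite -subr_eq0 -linearBr/= innerC pz ?conjC0//.
  exact: subspace_in.
have [P PP] := choice step.
have Plin : linear P.
  move=> c z w; apply/eqP; rewrite -subr_eq0; apply/eqP/subspace_orth0 => v.
  rewrite (linearB (embed S)) (linearP (embed S)) linearBr linearDr linearZr_LR/= -!PP.
  by rewrite linearDr linearZr_LR/= subrr.
have Pbnd z : rnorm (P z) <= 1 * rnorm z.
  rewrite mul1r; have [->|Pz0] := eqVneq (P z) 0; first by rewrite rnorm0 rnorm_ge0.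
  have nP : 0 < rnorm (P z) by rewrite rnorm_gt0.
  rewrite -(ler_pM2l nP) (le_trans _ (cauchy_schwarz (embed S (P z)) z))//.
  by rewrite /rinner PP inner_norm normrX normr_id rnormE -rmorphXn expr2.
have [T TP] := bop_of_bound Plin Pbnd.
suff : [set T : 'L(H, subspace_of S) | forall (x : subspace_of S) (y : H),
    inner (embed S x) y = inner x (T y)] (adjoint (embed S)) by apply.
by apply: (@xgetPex _ 0); exists T => v w; rewrite PP TP.
Qed.

Lemma adjoint_embedK (x : subspace_of S) : adjoint (embed S) (embed S x) = x.
Proof.
apply/eqP; rewrite -subr_eq0; apply/eqP/subspace_orth0 => w.
rewrite -[LHS]/(inner w (adjoint (embed S) (embed S x) - x)).
by rewrite linearBr/= -(adjoint_embedP w) subrr.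
Qed.

End Projection.

(** * The pencil on the initial value space *)

Lemma boundedly_invertible_of_bound (R : realType) (E F : normedModType R[i])
    (T : 'L(E, F)) (K : R) :
  (forall x, rnorm x <= K * rnorm (T x)) -> (forall y, exists x, T x = y) ->
  boundedly_invertible T.
Proof.
move=> TK Tsurj; have [f fP] := choice Tsurj.
have Tinj x y : T x = T y -> x = y.
  move=> Txy; apply/eqP; rewrite -subr_eq0; apply/eqP/rnorm0_eq0/eqP.
  by rewrite eq_le rnorm_ge0 (le_trans (TK _))// linearB/= Txy subrr rnorm0 mulr0.
have flin : linear f by move=> c y z; apply: Tinj; rewrite (linearP T)/= !fP.
have fbnd y : rnorm (f y) <= K * rnorm y by rewrite (le_trans (TK _))// fP.
have [S SP] := bop_of_bound flin fbnd; exists S.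
by split; apply: bop_ext => x /=; rewrite SP ?fP//; apply: Tinj; rewrite fP.
Qed.

Lemma binvP (R : realType) (E F : normedModType R[i]) (T : 'L(E, F)) :
  boundedly_invertible T -> is_binverse T (binv T).
Proof. by move=> Tinv; exact: (@xgetPex _ 0 (is_binverse T)). Qed.

Section Pencil.
Variables (R : realType) (H : hilbertType R) (M0 M1 : 'L(H, H)).
Hypotheses (cl : closed (range M0)) (reg : regular_pencil M0 M1).

(** Sampling along a real sequence with r n >= n + 1 makes 1 / r n an explicit
    null sequence. *)
Lemma resolvents : exists (C : R) (r : nat -> R) (Q : nat -> 'L(H, H)),
  forall n, [/\ n.+1%:R <= r n, forall x, rnorm (Q n x) <= C * rnorm x,
    forall x, Q n ((r n)%:C *: M0 x + M1 x) = x &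
    forall y, (r n)%:C *: M0 (Q n y) + M1 (Q n y) = y].
Proof.
have [nu [inv [B [Breal Bnd]]]] := reg.
pose r n : R := `|nu| + n.+1%:R.
have nur n : nu < complex.Re (r n)%:C.
  by rewrite (le_lt_trans (ler_norm _))// ltrDl.
exists (complex.Re B + 1), r, (fun n => binv (pencil M0 M1 (r n)%:C)) => n.
have [/(congr1 (@bop_fun _ _ _)) QT /(congr1 (@bop_fun _ _ _)) TQ] :=
  binvP (inv _ (nur n)).
split.
- by rewrite lerDr.
- move=> x; rewrite (le_trans (rnorm_bop _ _))// ler_wpM2r ?rnorm_ge0//.
  rewrite -rnorm_le.
  have BB : B < (complex.Re B + 1)%:C by rewrite rmorphD/= RRe_real// ltrDl ltcR.
  exact: (Bnd _ BB _ (nur n)).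
- by move=> x; have := congr1 (@^~ x) QT.
- by move=> y; have := congr1 (@^~ y) TQ.
Qed.

Let D := range_csub cl.

Lemma IV_in x : IV M0 M1 x <-> (D : set H) (M1 x).
Proof. by []. Qed.

(** On R(M0) the resolvents decay like 1/r, as r Q r M0 w = w - Q r M1 w is
    bounded for each w and R(M0) is complete. *)
Lemma rescaled_resolvents : exists (K : R) (r : nat -> R) (Q : nat -> 'L(H, H)),
  0 <= K /\ forall n, [/\ n.+1%:R <= r n,
    forall y, range M0 y -> rnorm (Q n y) <= K * rnorm y / r n,
    forall x, Q n ((r n)%:C *: M0 x + M1 x) = x &
    forall y, (r n)%:C *: M0 (Q n y) + M1 (Q n y) = y].
Proof.
have [C [r [Q QP]]] := resolvents.
have [K KP] : exists K, forall n (y : subspace_of D),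
    rnorm (bcomp ((r n)%:C *: Q n) (embed D) y) <= K * rnorm y.
  apply: uniform_boundedness => y.
  have [w _ wy] := subspace_in y.
  exists (rnorm w + C * rnorm (M1 w)) => n; have [_ QC QT _] := QP n.
  change (rnorm ((r n)%:C *: Q n (embed D y)) <= rnorm w + C * rnorm (M1 w)).
  rewrite -wy -linearZ/=.
  have -> : Q n ((r n)%:C *: M0 w) = w - Q n (M1 w).
    by rewrite -{2}(QT w) linearD addrK.
  by rewrite (le_trans (rnormB _ _))// lerD2l.
exists `|K|, r, Q; split=> // n; have [rn _ QT TQ] := QP n; split => // y Dy.
have r0 : 0 < r n by rewrite (lt_le_trans _ rn).
rewrite ler_pdivlMr// mulrC.
have := KP n (SubspaceOf (mem_set Dy : y \in csub_pred D)).
rewrite /= -[(_ *: _) _]/((r n)%:C *: Q n _) rnormZ (gtr0_norm r0) => h.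
by rewrite (le_trans h)// ler_wpM2r ?rnorm_ge0 ?ler_norm.
Qed.

(** For x in IV, write M1 x = M0 w; then x = r Q r M0 x + Q r M0 w, where the
    last term vanishes as r tends to infinity. *)
Lemma M0_bounded_below : exists2 K : R, 0 <= K &
  forall x, IV M0 M1 x -> rnorm x <= K * rnorm (M0 x).
Proof.
have [K [r [Q [K0 QP]]]] := rescaled_resolvents; exists K => // x IVx.
apply/ler_addgt0Pl => e e0; have [w _ wx] := IVx.
(* This n makes the last term at most e. *)
pose n := Num.trunc (K * rnorm (M0 w) / e).
have [rn QK QT _] := QP n.
have r0 : 0 < r n by rewrite (lt_le_trans _ rn).
rewrite -{1}(QT x) linearD addrC (le_trans (rnormD _ _))// lerD//; last first.
  rewrite linearZ/= rnormZ gtr0_norm// -ler_pdivlMl//.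
  by rewrite [leRHS]mulrC QK//; exists x.
rewrite -wx (le_trans (QK _ (imageT M0 w)))//.
rewrite ler_pdivrMr// [leRHS]mulrC -ler_pdivrMr// (le_trans _ rn)//.
by rewrite ltW// truncnS_gt.
Qed.

(** The points r Q r y are approximate preimages of y in IV, and the lower
    bound of [M0_bounded_below] turns the convergence of their images into
    their own. *)
Lemma M0_IV_surjective y : range M0 y -> exists2 x, IV M0 M1 x & M0 x = y.
Proof.
move=> Dy; have [K0 K00 M0K] := M0_bounded_below.
have [K [r [Q [K1 QP]]]] := rescaled_resolvents.
have r0 n : 0 < r n by have [rn _ _ _] := QP n; rewrite (lt_le_trans _ rn).
pose x n := (r n)%:C *: Q n y.
have xE n : M0 (x n) = y - M1 (Q n y).
  by have [_ _ _ /(_ y) TQ] := QP n; rewrite linearZ/= -{2}TQ addrK.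
have xIV n : (IV_csub M1 cl : set H) (x n).
  apply/IV_in; rewrite linearZ/=; apply: (@csubZ _ _ D).
  have -> : M1 (Q n y) = y - M0 (x n) by rewrite xE opprB addrC subrK.
  by apply: (@csubB _ _ D) => //; exists (x n).
pose c := rnorm M1 * (K * rnorm y).
have c0 : 0 <= c by rewrite !mulr_ge0 ?rnorm_ge0.
have xc n : rnorm (M0 (x n) - y) <= c * n.+1%:R^-1.
  have [rn QK _ _] := QP n.
  rewrite xE addrAC subrr sub0r rnormN (le_trans (rnorm_bop _ _))//.
  rewrite -mulrA ler_wpM2l ?rnorm_ge0// (le_trans (QK _ _))//.
  by rewrite ler_wpM2l ?mulr_ge0 ?rnorm_ge0// lef_pV2 ?posrE.
have small e : 0 < e -> exists n, K0 * (c * n.+1%:R^-1) *+ 2 <= e.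
  move=> e0; exists (Num.trunc (K0 * c *+ 2 / e)).
  rewrite mulrA -mulrnAl ler_pdivrMr// [leRHS]mulrC -ler_pdivrMr//.
  by rewrite ltW// truncnS_gt.
have [|l xl _] := @cvg_modulus _ _ x (fun n => K0 * (c * n.+1%:R^-1) *+ 2) _ small.
  move=> n m nm; have Dx : IV M0 M1 (x m - x n) by apply: (@csubB _ _ (IV_csub M1 cl)).
  rewrite (le_trans (M0K _ Dx))// -mulrnAr ler_wpM2l// linearB.
  rewrite (le_trans (rnorm_tri y _ _))// mulr2n; apply: lerD.
    by rewrite (le_trans (xc _))// ler_wpM2l// lef_pV2 ?posrE// ler_nat.
  by rewrite rnorm_sym; exact: xc.
exists l; first by apply: (@csub_cvg _ _ (IV_csub M1 cl)) xl; exact: nearW.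
have M0xl : M0 \o x @ \oo --> M0 l.
  by apply: continuous_cvg => //; exact: bop_continuous.
have M0xy : M0 \o x @ \oo --> y.
  apply/cvg_rnormP => e e0; exists (Num.trunc (c / e)) => // n /= nN.
  rewrite (le_trans (xc n))// ler_pdivrMr// [leRHS]mulrC -ler_pdivrMr//.
  by rewrite ltW// (lt_le_trans (truncnS_gt _))// ler_nat.
by rewrite -(cvg_lim (@norm_hausdorff _ _) M0xl) (cvg_lim (@norm_hausdorff _ _) M0xy).
Qed.

Lemma compress_M0E x :
  embed D (compress M1 cl M0 x) = M0 (embed (IV_csub M1 cl) x).
Proof.
have Dx : M0 (embed (IV_csub M1 cl) x) \in csub_pred D.
  by apply: mem_set; exists (embed (IV_csub M1 cl) x).
exact: (congr1 (embed D) (adjoint_embedK (SubspaceOf Dx))).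
Qed.

Lemma compress_M1E x :
  embed D (compress M1 cl M1 x) = M1 (embed (IV_csub M1 cl) x).
Proof.
have Dx : M1 (embed (IV_csub M1 cl) x) \in csub_pred D.
  by apply: mem_set; exact: subspace_in x.
exact: (congr1 (embed D) (adjoint_embedK (SubspaceOf Dx))).
Qed.

Lemma compress_invertible : boundedly_invertible (compress M1 cl M0).
Proof.
have [K _ M0K] := M0_bounded_below.
apply: (@boundedly_invertible_of_bound _ _ _ _ K) => [x|y].
  rewrite -[rnorm x]/(rnorm (embed _ x)) (le_trans (M0K _ (subspace_in x)))//.
  by rewrite -compress_M0E.
have [x IVx xy] := M0_IV_surjective (subspace_in y).
exists (SubspaceOf (mem_set IVx : x \in csub_pred (IV_csub M1 cl))).
by apply: val_inj; rewrite -[LHS]/(embed D _) compress_M0E.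
Qed.

End Pencil.

(** * Differentiation in a Hilbert space and Gronwall's inequality *)

Section DerivativeOfNorm.
Variables (R : realType) (H : hilbertType R).
Implicit Types (x y : H) (w u v : R -> H).

Definition re_inner x y : R := complex.Re (inner x y).

Lemma re_inner_le x y : `|re_inner x y| <= rnorm x * rnorm y.
Proof.
rewrite (le_trans _ (cauchy_schwarz x y))// -lecR -rinnerE.
exact: normc_ge_Re.
Qed.

Lemma re_innerB x y z : re_inner x (y - z) = re_inner x y - re_inner x z.
Proof. by rewrite /re_inner linearBr raddfB. Qed.

Lemma re_innerZ x y (r : R) : re_inner x (r%:C *: y) = r * re_inner x y.
Proof.
rewrite /re_inner linearZr_LR/= conj_Creal ?complex_real//.
by case: (inner x y) => a b /=; rewrite mul0r subr0.
Qed.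

Lemma rnormD_sqr x y :
  rnorm (x + y) ^+ 2 = rnorm x ^+ 2 + rnorm y ^+ 2 + 2 * re_inner x y.
Proof.
apply: (@complexI R); rewrite -innerxx dnormD !rmorphD/= -!innerxx.
congr (_ + _).
by rewrite /re_inner; case: (inner x y) => a b; apply/eqP; rewrite eq_complex/=;
 apply/andP; split; apply/eqP; ring.
Qed.

Lemma rnorm_continuous : continuous (@rnorm R H).
Proof.
move=> x; apply/cvgrPdist_le => e e0.
have /cvg_rnormP/(_ _ e0) := @cvg_id _ (nbhs x) _.
apply: filterS => y; apply: le_trans.
have := rnorm_tri y x 0; have := rnorm_tri x y 0; rewrite !subr0 (rnorm_sym y x).
by rewrite ler_norml => *; lra.
Qed.

Lemma re_inner_continuous x : continuous (re_inner x).
Proof.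
move=> y; apply/cvgrPdist_le => e e0.
have x1 : 0 < rnorm x + 1 by rewrite ltr_wpDl ?rnorm_ge0.
have /cvg_rnormP/(_ _ (divr_gt0 e0 x1)) := @cvg_id _ (nbhs y) _.
apply: filterS => z; rewrite ler_pdivlMr// => zy.
rewrite -re_innerB (le_trans (re_inner_le _ _))// rnorm_sym.
by rewrite (le_trans _ zy)// mulrC ler_wpM2l ?rnorm_ge0// lerDl.
Qed.

Lemma is_derivativeB u v t du dv :
  is_derivative u t du -> is_derivative v t dv ->
  is_derivative (u \- v) t (du - dv).
Proof.
move=> ut vt; rewrite /is_derivative.
under eq_fun do rewrite /= opprD addrACA -opprD scalerBr.
exact: cvgB ut vt.
Qed.

(** The exponential is known through a quadratic remainder, not through its
    difference quotients. *)
Lemma is_derivative_of_remainder u t du (M : R) :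
  (forall h : R, `|h| <= 1 ->
     rnorm (u (h + t) - u t - h%:C *: du) <= h ^+ 2 * M) ->
  is_derivative u t du.
Proof.
move=> uM; have M0 : 0 <= M.
  have := uM 1; rewrite normr1 => /(_ (lexx _)); rewrite expr1n mul1r.
  exact/le_trans/rnorm_ge0.
apply/cvg_rnormP => e e0.
have d0 : 0 < Num.min 1 (e / (M + 1)).
  by rewrite lt_min ltr01 divr_gt0// ltr_wpDl.
have := nbhs_dnbhs_neq (0 : R); have := @dnbhs0_le _ R _ d0.
apply: filterS2 => h; rewrite le_min => /andP[h1 he] h0.
have -> : h^-1%:C *: (u (h + t) - u t) - du =
    h^-1%:C *: (u (h + t) - u t - h%:C *: du).
  by rewrite [RHS]scalerBr scalerA -rmorphM mulVf// scale1r.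
have nh : 0 < `|h| by rewrite normr_gt0.
rewrite rnormZ normfV ler_pdivrMl// (le_trans (uM _ h1))//.
rewrite -real_normK ?num_real// expr2 -mulrA ler_wpM2l//.
rewrite (@le_trans _ _ (`|h| * (M + 1)))//; first by rewrite ler_wpM2l ?lerDl.
by rewrite -ler_pdivlMr// ltr_wpDl.
Qed.

(** The difference quotient is h |q|^2 + 2 Re <w t, q>, where q is the
    difference quotient of w. *)
Lemma is_derive_rnorm_sqr w t dw : is_derivative w t dw ->
  is_derive t 1 (fun s => rnorm (w s) ^+ 2) (2 * re_inner (w t) dw).
Proof.
move=> wt; set f := fun s => _.
have ft : (fun h : R => h^-1 *: ((f \o shift t) (h *: (1 : R)) - f t)) @ 0^' -->
    2 * re_inner (w t) dw.
  pose q (h : R) := h^-1%:C *: (w (h + t) - w t).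
  rewrite (_ : (fun h : R => _) =
      (fun h => h * (rnorm (q h) * rnorm (q h)) + 2 * re_inner (w t) (q h))).
    rewrite -[X in _ --> X]add0r -[X in _ --> X + _](mul0r (rnorm dw * rnorm dw)).
    apply: cvgD.
      apply: cvgM; first exact: nbhs_dnbhs.
      by apply: cvgM; apply: (continuous_cvg _ (@rnorm_continuous dw) wt).
    apply: cvgMr.
    exact: (continuous_cvg _ (@re_inner_continuous (w t) dw) wt).
  apply/funext => h; rewrite /f/= -[h *: 1]/(h * 1) mulr1.
  have -> : w (h + t) = w t + (w (h + t) - w t) by rewrite [RHS]addrC subrK.
  rewrite rnormD_sqr /q rnormZ re_innerZ.
  (* At h = 0 both sides vanish, as the inverse of 0 is 0. *)
  have [->|h0] := eqVneq h 0.
    by rewrite invr0 normr0 !mul0r mulr0 addr0 scale0r.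
  rewrite -[_ *: _]/(_ * _) mulrACA -expr2 real_normK ?num_real//.
  by move: (rnorm _) (rnorm _) (re_inner _ _) => a b c; field.
by apply: DeriveDef; [exact: cvgP ft|exact: cvg_lim ft].
Qed.

(** Gronwall's inequality for functions starting at 0: the nonnegative function
    exp (- 2 b t) |w t|^2 vanishes at 0 and has a nonpositive derivative. *)
Lemma gronwall w dw (b : R) :
  {within `[0, +oo[, continuous w} -> w 0 = 0 ->
  (forall t : R, 0 < t -> is_derivative w t (dw t)) ->
  (forall t : R, 0 < t -> rnorm (dw t) <= b * rnorm (w t)) ->
  forall t, 0 <= t -> w t = 0.
Proof.
move=> wc w0 wd wb t t0.
pose g := (fun s : R => expR (- (2 * b) * s)) * (fun s => rnorm (w s) ^+ 2).
have gd (s : R) : 0 < s -> is_derive s 1 g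
   (expR (- (2 * b) * s) * (2 * re_inner (w s) (dw s)) +
    rnorm (w s) ^+ 2 * (- (2 * b) * expR (- (2 * b) * s))).
  move=> s0; have := is_derive_rnorm_sqr (wd s s0) => d1.
  have d2 : is_derive s 1 (fun s : R => expR (- (2 * b) * s))
     (- (2 * b) * expR (- (2 * b) * s)).
    have dk : is_derive s 1 (fun s : R => - (2 * b) * s) (- (2 * b)).
      by apply: is_derive_eq (is_deriveZ _ (is_derive_id _ _)) _; exact: mulr1.
    apply: is_derive_eq (is_derive1_comp (is_derive_expR _) dk) _.
    exact: mulrC.
  exact: is_deriveM.
have gle : g t <= g 0.
  apply: (@ler0_derive1_nincry R g 0 _ _ _ 0 t (lexx 0) t0).
  - by move=> s; rewrite in_itv/= andbT => /gd [].
  - move=> s; rewrite in_itv/= andbT => s0; rewrite derive1E.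
    have [_ ->] := gd s s0.
    have e0 := expR_ge0 (- (2 * b) * s).
    have h1 := wb s s0; have h2 := rnorm_ge0 (w s).
    have h3 := re_inner_le (w s) (dw s).
    have h4 : re_inner (w s) (dw s) <= b * rnorm (w s) ^+ 2.
      rewrite (le_trans (ler_norm _))// (le_trans h3)//.
      by rewrite expr2 mulrCA ler_wpM2l.
    have := ler_wpM2l e0 h4; lra.
  - have ec : {within `[0, +oo[, continuous (fun s : R => expR (- (2 * b) * s))}.
      apply: continuous_subspaceT => s; apply: continuous_comp.
        exact: mulrl_continuous.
      exact: continuous_expR.
    have nc : {within `[0, +oo[, continuous (fun s : R => rnorm (w s))}.
      by move=> s; apply: continuous_comp (wc s) _; exact: rnorm_continuous.
    move=> s; apply: (@continuousM _ (subspace _)); first exact: ec.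
    by apply: (@continuousM _ (subspace _)); exact: nc.
move: gle; rewrite /g/= -[X in X <= _]/(_ * _) -[X in _ <= X]/(_ * _) w0 rnorm0.
rewrite expr0n mulr0 pmulr_rle0 ?expR_gt0// => h.
by apply: rnorm0_eq0; apply/eqP; rewrite -sqrf_eq0 eq_le h sqr_ge0.
Qed.

End DerivativeOfNorm.

(** * The initial value problem *)

Section ExponentialFlow.
Variables (R : realType) (E : completeNormedModType R[i]) (A : 'L(E, E)).

Lemma bexp_flow_remainder (x : E) (t h : R) : `|h| <= 1 ->
  rnorm (bexp ((- (h + t))%:C *: A) x - bexp ((- t)%:C *: A) x
         + h%:C *: A (bexp ((- t)%:C *: A) x))
  <= h ^+ 2 * (expR ((`|t| + 2) * rnorm A) * rnorm x).
Proof.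
move=> h1; have := @bexp_remainder _ _ A (- t) (- h).
rewrite !normrN sqrrN -opprD [t + h]addrC => /(_ h1) rem.
rewrite mulrA (le_trans _ (ler_wpM2r (rnorm_ge0 x) rem))//.
rewrite (le_trans _ (rnorm_bop _ x))//.
by rewrite [(- h)%:C]rmorphN/= scaleNr opprK.
Qed.

Lemma bexp_flow_continuous (x : E) :
  continuous (fun t : R => bexp ((- t)%:C *: A) x).
Proof.
move=> t; apply/cvg_rnormP => e e0.
pose f (s : R) := bexp ((- s)%:C *: A) x.
pose K := rnorm (A (f t)) + expR ((`|t| + 2) * rnorm A) * rnorm x + 1.
have K0 : 0 < K by rewrite ltr_wpDl// addr_ge0 ?mulr_ge0 ?rnorm_ge0 ?expR_ge0.
have d0 : 0 < Num.min 1 (e / K) by rewrite lt_min ltr01 divr_gt0.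
have /cvgrPdist_le/(_ _ d0) := @cvg_id _ (nbhs t) _.
apply: filterS => s; rewrite le_min distrC => /andP[h1 he].
have := bexp_flow_remainder x t h1; rewrite subrK -/(f s) -/(f t).
set h := s - t in h1 he * => rem.
have -> : f s - f t = (f s - f t + h%:C *: A (f t)) - h%:C *: A (f t).
  by rewrite addrK.
rewrite (le_trans (rnormB _ _))// rnormZ.
have hh : h ^+ 2 * (expR ((`|t| + 2) * rnorm A) * rnorm x) <=
    `|h| * (expR ((`|t| + 2) * rnorm A) * rnorm x).
  rewrite ler_wpM2r ?mulr_ge0 ?rnorm_ge0 ?expR_ge0//.
  by rewrite -real_normK ?num_real// expr2 ler_piMr.
rewrite (le_trans (lerD (le_trans rem hh) (lexx _)))// -mulrDr.
apply: (@le_trans _ _ (`|h| * K)); last by rewrite -ler_pdivlMr.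
by rewrite ler_wpM2l// /K [leLHS]addrC lerDl.
Qed.

End ExponentialFlow.

Section Flow.
Variables (R : realType) (H : hilbertType R) (M0 M1 : 'L(H, H)).
Hypotheses (cl : closed (range M0)) (reg : regular_pencil M0 M1).

Let S := IV_csub M1 cl.
Let B : 'L(subspace_of S, subspace_of S) :=
  bcomp (binv (compress M1 cl M0)) (compress M1 cl M1).

(** The compressions agree with M0 and M1 on IV, where B is thus M0^-1 M1. *)
Lemma M0_generator x : M0 (embed S (B x)) = M1 (embed S x).
Proof.
rewrite -compress_M0E -compress_M1E.
have [_ TQ] := binvP (compress_invertible cl reg).
by congr (embed _ _); exact: (congr1 (fun T : 'L(_, _) => T (compress M1 cl M1 x)) TQ).
Qed.

Lemma flow_solution (x : subspace_of S) :
  ivp_solution M0 M1 (embed S x) (fun t => embed S (bexp ((- t)%:C *: B) x)).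
Proof.
have embed_cont : continuous (embed S) by exact: bop_continuous.
have flow_cont : continuous (fun t : R => bexp ((- t)%:C *: B) x).
  exact: bexp_flow_continuous.
have B_cont : continuous B by exact: bop_continuous.
split.
- apply: continuous_subspaceT => t.
  exact: (continuous_comp (flow_cont t) (embed_cont _)).
- by rewrite oppr0 bexp0.
exists (fun t => - embed S (B (bexp ((- t)%:C *: B) x))); split.
- move=> t _; apply: (is_derivative_of_remainder
    (M := expR ((`|t| + 2) * rnorm B) * rnorm x)) => h h1.
  rewrite scalerN opprK; exact: (bexp_flow_remainder B x t h1).
- apply: continuous_subspaceT => t; apply: cvgN.
  have Bflow_cont := continuous_comp (flow_cont t) (B_cont _).
  exact: (continuous_comp Bflow_cont (embed_cont _)).
- by move=> t _; rewrite linearN/= M0_generator addNr.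
Qed.

(** The equation puts M1 (v t) in R(M0), hence v t in IV. As IV is closed and
    linear, it also contains the derivative of v, and there M0 is injective, so
    that the equation can be solved for the derivative. *)
Lemma solution_ode u0 (v : R -> H) : ivp_solution M0 M1 u0 v ->
  exists dv : R -> H, forall t : R, 0 < t -> is_derivative v t (dv t) /\
    exists2 x, v t = embed S x & dv t = - embed S (B x).
Proof.
move=> [_ _ [dv [vd _ veq]]]; exists dv => t t0; split; first exact: vd.
have IVv s : 0 < s -> (S : set H) (v s).
  move=> s0; exists (- dv s) => //; rewrite linearN.
  by apply/eqP; rewrite eq_sym -subr_eq0 opprK addrC veq.
have IVdv : (S : set H) (dv t).
  apply: csub_cvg (vd t t0).
  have := nbhs_dnbhs (nbhs0_lt t0 : \forall h \near (0:R), _).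
  apply: filterS => h; rewrite ltr_norml => /andP[ht _].
  apply/csubZ/csubB; apply: IVv => //.
  by rewrite -ltrBlDr sub0r.
pose x : subspace_of S := SubspaceOf (mem_set (IVv t t0)).
exists x => //; apply/eqP; rewrite -subr_eq0 opprK.
have [K _ M0K] := M0_bounded_below cl reg.
apply/eqP/rnorm0_eq0/eqP; rewrite eq_le rnorm_ge0 andbT.
rewrite (le_trans (M0K _ _))//.
  by apply: (@csubD _ _ S) => //; exact: subspace_in.
have -> : M0 (dv t + embed S (B x)) = M0 (dv t) + M1 (v t).
  by rewrite -[v t]/(embed S x) -M0_generator -linearD.
by rewrite veq// rnorm0 mulr0.
Qed.

Lemma solution_unique u0 (u v : R -> H) :
  ivp_solution M0 M1 u0 u -> ivp_solution M0 M1 u0 v ->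
  forall t, 0 <= t -> v t = u t.
Proof.
move=> us vs t t0; apply/eqP; rewrite -subr_eq0; apply/eqP.
have [du du_ode] := solution_ode us; have [dv dv_ode] := solution_ode vs.
have [uc u00 _] := us; have [vc v00 _] := vs.
apply: (@gronwall _ _ (v \- u) (dv \- du) (rnorm B)) => //.
- by move=> s; apply: (@cvgB _ _ (subspace _)); [exact: vc|exact: uc].
- by rewrite /= u00 v00 subrr.
- by move=> s s0; apply: is_derivativeB; [case: (dv_ode s s0)|case: (du_ode s s0)].
move=> s s0 /=; have [_ [x -> ->]] := dv_ode s s0; have [_ [y -> ->]] := du_ode s s0.
rewrite -opprD rnormN -linearB -linearB -linearB.
exact: (rnorm_bop B (x - y)).
Qed.

End Flow.

Theorem corollary4p5 (R : realType) (H : hilbertType R) (M0 M1 : 'L(H, H))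
    (cl : closed (range M0)) (reg : regular_pencil M0 M1)
    (u0 : H) (u0IV : u0 \in IV M0 M1) :
  boundedly_invertible (compress M1 cl M0) /\
  exists u : R -> H,
    [/\ ivp_solution M0 M1 u0 u,
        forall v : R -> H, ivp_solution M0 M1 u0 v ->
          forall t, 0 <= t -> v t = u t &
        forall t : R, 0 <= t ->
          u t = embed (IV_csub M1 cl)
            (bexp ((- t)%:C *: bcomp (binv (compress M1 cl M0)) (compress M1 cl M1))
              (@SubspaceOf R H (IV_csub M1 cl) u0 u0IV))].
Proof.
split; first exact: compress_invertible.
pose x0 : subspace_of (IV_csub M1 cl) := @SubspaceOf R H (IV_csub M1 cl) u0 u0IV.
have sol := flow_solution reg x0.
eexists; split; [exact: sol| |by []].
by move=> v vs; exact: (solution_unique cl reg sol vs).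
Qed.
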